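(* Let $(X,\mathbb{A},d)$ be a $C^{\ast}$-algebra valued metric space and let $C_{x_0,r}^{C^{\ast}}$ be any circle on $X$ (with $x_0\in X$, $r\in\mathbb{A}_+$). Define $\varphi:X\to\mathbb{A}_+$ by $\varphi(x)=d(x,x_0)$ for all $x\in X$. Let $T:X\to X$ be a self-mapping satisfying $$d(x,Tx)\preceq \varphi(x)-\varphi(Tx)\qquad\text{and}\qquad r\preceq d(Tx,x_0)$$ for all $x\in C_{x_0,r}^{C^{\ast}}$. If $T$ satisfies the contraction condition $$d(Tx,Ty)\preceq A^{\ast}d(x,y)A$$ for all $x\in C_{x_0,r}^{C^{\ast}}$, $y\in X\setminus C_{x_0,r}^{C^{\ast}}$ and some $A\in\mathbb{A}$ with $\|A\|<1$, then the circle $C_{x_0,r}^{C^{\ast}}$ is the unique fixed circle of $T$.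
   Context: $\mathbb{A}$ is a unital $C^{\ast}$-algebra with unit $I$ and zero element $\theta$. $\mathbb{A}_h=\{a\in\mathbb{A}: a=a^{\ast}\}$. An element $a\in\mathbb{A}$ is positive, written $\theta\preceq a$, if $a\in\mathbb{A}_h$ and its spectrum is contained in $[0,\infty)$; $\mathbb{A}_+$ is the set of positive elements (so $\theta\in\mathbb{A}_+$). For $a,b\in\mathbb{A}_h$, $a\preceq b$ means $b-a\in\mathbb{A}_+$. A $C^{\ast}$-algebra valued metric space $(X,\mathbb{A},d)$ is a nonempty set $X$ with a map $d:X\times X\to\mathbb{A}$ such that for all $x,y,z\in X$: (i) $\theta\preceq d(x,y)$, and $d(x,y)=\theta$ if and only if $x=y$; (ii) $d(x,y)=d(y,x)$; (iii) $d(x,y)\preceq d(x,z)+d(z,y)$. For $x_0\in X$ and $r\in\mathbb{A}_+$, the circle with center $x_0$ and radius $r$ is $C_{x_0,r}^{C^{\ast}}=\{x\in X: d(x,x_0)=r\}$. For a self-mapping $T:X\to X$, the circle $C_{x_0,r}^{C^{\ast}}$ is called a fixed circle of $T$ if $Tx=x$ for all $x\in C_{x_0,r}^{C^{\ast}}$. The element $A$ in the contraction condition is the same for all $x,y$.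
   Formalization: Uniqueness is claimed only when the circle is nonempty, and among fixed circles (as sets) that are not proper subsets of it: circles inside it, such as the radius-θ circle {x}, are always fixed too, and for an empty circle the hypotheses are vacuous, so the literal uniqueness is false. *)

(* Defs.v *)
(* Written in MathComp, with sets and realType from MathComp-Analysis. *)
From HB Require Import structures.
From mathcomp Require Import all_boot all_order all_algebra.
From mathcomp Require Import complex.
From mathcomp Require Import all_classical all_reals.
Set Implicit Arguments.
Unset Strict Implicit.
Unset Printing Implicit Defensive.
Import Order.TTheory GRing.Theory Num.Theory.
Local Open Scope classical_set_scope.
Local Open Scope complex_scope.
Local Open Scope ring_scope.

(* The library has no structure joining rings and normed modules, and none can be
   declared downstream of numDomainType, which inherits from both; hence the norm
   and its completeness are added here to algType, which is unital with 1 != 0. *)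
HB.mixin Record isCStarAlgebra (R : realType) A of GRing.Algebra R[i] A := {
  cnorm : A -> R;
  cnorm_eq0 : forall a : A, cnorm a = 0 -> a = 0;
  cnormZ : forall (k : R[i]) (a : A), (cnorm (k *: a))%:C = `|k| * (cnorm a)%:C;
  cnormD : forall a b : A, cnorm (a + b) <= cnorm a + cnorm b;
  cnormM : forall a b : A, cnorm (a * b) <= cnorm a * cnorm b;
  cnorm_complete : forall u : nat -> A,
    (forall e : R, 0 < e -> exists N : nat, forall m n : nat,
       (N <= m)%N -> (N <= n)%N -> cnorm (u m - u n) < e) ->
    exists l : A, forall e : R, 0 < e -> exists N : nat, forall n : nat,
      (N <= n)%N -> cnorm (u n - l) < e;
  star : A -> A;
  starK : involutive star;
  starD : {morph star : a b / a + b};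
  starZ : forall (k : R[i]) (a : A), star (k *: a) = conjc k *: star a;
  starM : forall a b : A, star (a * b) = star b * star a;
  cnorm_star : forall a : A, cnorm (star a * a) = cnorm a ^+ 2
}.

#[short(type="cstarAlgType")]
HB.structure Definition CStarAlgebra (R : realType) :=
  {A of isCStarAlgebra R A & GRing.Algebra R[i] A}.

Section CStarOrder.
Variables (R : realType) (A : cstarAlgType R).
Implicit Types a b : A.

Definition hermitian a : Prop := star a = a.

Definition invertible a : Prop := exists b, a * b = 1 /\ b * a = 1.

Definition spectrum a : set R[i] := [set k : R[i] | ~ invertible (k%:A - a)].

(* In the order of R[i], 0 <= k says that k is real and nonnegative. *)
Definition positive a : Prop :=
  hermitian a /\ spectrum a `<=` [set k : R[i] | 0 <= k].

Definition cstar_le a b : Prop :=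
  [/\ hermitian a, hermitian b & positive (b - a)].

End CStarOrder.

Notation "a ⪯ b" := (cstar_le a b) (at level 70, no associativity).

Section CStarMetric.
Variables (R : realType) (A : cstarAlgType R) (X : Type).

Record cstar_metric_space (d : X -> X -> A) : Prop := {
  cmetric_inhabited : inhabited X;
  cmetric_ge0 : forall x y, 0 ⪯ d x y;
  cmetric_eq0 : forall x y, d x y = 0 <-> x = y;
  cmetric_sym : forall x y, d x y = d y x;
  cmetric_triangle : forall x y z, d x y ⪯ d x z + d z y
}.

Definition circle (d : X -> X -> A) (x0 : X) (r : A) : set X :=
  [set x | d x x0 = r].

Definition fixed_circle (d : X -> X -> A) (T : X -> X) (x0 : X) (r : A) : Prop :=
  forall x, circle d x0 r x -> T x = x.

(* Circles are compared as sets of points, since distinct pairs (x0, r) may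
   describe the same circle.  Every circle lying inside a fixed circle, such as
   the degenerate circle(x, 0) = {x} or an empty one, is trivially fixed as
   well: these are the only fixed circles not counted as competitors, hence the
   exclusion of the proper subsets.  If the circle itself is empty, being fixed
   carries no information, and no uniqueness is claimed. *)
Definition unique_fixed_circle (d : X -> X -> A) (T : X -> X) (x0 : X) (r : A) :
    Prop :=
  fixed_circle d T x0 r /\
  (circle d x0 r !=set0 ->
   forall (x1 : X) (r1 : A), positive r1 -> fixed_circle d T x1 r1 ->
     ~ (circle d x1 r1 `<` circle d x0 r) ->
     circle d x1 r1 = circle d x0 r).

End CStarMetric.

(* Main.v *)
Require Import Defs.
From mathcomp Require Import all_boot all_order all_algebra.
From mathcomp Require Import complex.
From mathcomp Require Import all_classical all_reals.
From mathcomp Require Import topology normedtype sequences.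
From mathcomp Require Import ring lra.
Import Order.TTheory GRing.Theory Num.Theory.
Import ComplexField.Normc numFieldNormedType.Exports.
Local Open Scope classical_set_scope.
Local Open Scope complex_scope.
Local Open Scope ring_scope.

(** Two facts about the order of a C*-algebra carry the theorem: three positive
    elements with sum 0 vanish, and 0 ⪯ a ⪯ b implies ||a|| <= ||b||.

    If x lies on the circle, then d(x, Tx), (r - d(Tx, x0)) - d(x, Tx) and
    d(Tx, x0) - r are positive with sum 0, so d(x, Tx) = 0 and the circle is
    fixed.  If another fixed circle had a point y off the circle, then
    d(x, y) = d(Tx, Ty) ⪯ a* d(x, y) a would give
    ||d(x, y)|| <= ||a||^2 ||d(x, y)||, hence x = y, which is absurd.  So every
    fixed circle is contained in the given one, and it equals it unless the
    inclusion is proper.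

    Both facts are instances of ||p|| <= ||p + q + w|| for positive p, q, w
    ([cnorm_le_positive_sum]).  With t = ||q|| and s = ||w||, the triangle
    inequality for p + (t + s) = (p + q + w) + (t - q) + (s - w) reduces it to
    ||t - q|| <= t, ||s - w|| <= s and ||p|| + t + s <= ||p + (t + s)||.  These
    compare norms with spectra, and rest on the theorem that the norm of a
    hermitian element is bounded by its spectral radius
    ([cnorm_le_spectral_bound]).

    The latter is proved without complex analysis.  Let u be hermitian of norm 1
    and suppose that 1 - zu is invertible for all |z| <= 1.  Its inverse G_0(z) is
    bounded on the disk by compactness, so for some s < 1 the elements G_0(z)
    and G_0(sz) are at distance at most 1/4, for all z in the disk.  Put
    G_n(z) = (1 - (zu)^(2^n))^-1.  For p = (zu)^(2^n), 1 - p^2 = (1 - p)(1 + p)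
    and partial fractions give G_(n+1)(z) = (G_n(z) + G_n(wz)) / 2, where
    w^(2^n) = -1; so the bound 1/4 passes from n to n + 1.  As n grows, G_n(s)
    tends to 1, whereas G_n(1) stays away from 1 since ||u^(2^n)|| = 1 for all n
    by the C*-identity.  This is a contradiction. *)

Set Implicit Arguments.
Unset Strict Implicit.

(* The algebra library uses the same name for sesquilinear forms. *)
Local Notation hermitian := Defs.hermitian.

(** * The closed unit disk of the complex numbers *)

Section Complex.
Variable R : realType.
Implicit Types z : R[i].

Lemma normc_ge0 z : 0 <= normc z.
Proof. by case: z => x y; exact: sqrtr_ge0. Qed.

Lemma normc_real (x : R) : normc x%:C = `|x|.
Proof. by rewrite /= expr0n addr0 sqrtr_sqr. Qed.

Lemma le_normc_coord (x y : R) : normc (x +i* y) <= `|x| + `|y|.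
Proof.
rewrite -[leRHS]ger0_norm ?addr_ge0 // -sqrtr_sqr ler_sqrt ?sqr_ge0 //.
rewrite sqrrD !real_normK ?num_real // -addrA lerD2l lerDr.
by rewrite mulrn_wge0 // mulr_ge0.
Qed.

Lemma coord_le_normc (x y : R) : `|x| <= normc (x +i* y) /\ `|y| <= normc (x +i* y).
Proof.
by split; rewrite /= -sqrtr_sqr ler_sqrt ?addr_ge0 ?sqr_ge0 // ?lerDl ?lerDr sqr_ge0.
Qed.

(** Compactness of the disk, for bounds M expressed by a relation B z M that is
    monotone in M, so that B may also quantify over partially defined values.
    The square [-1, 1]^2 supplies the compactness; around its points outside the
    disk there is nothing to bound, because the complement is open. *)
Lemma locally_bounded_on_unit_disk (B : R[i] -> R -> Prop) :
  (forall z M M', M <= M' -> B z M -> B z M') ->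
  (forall z, normc z <= 1 -> exists2 e : R, 0 < e &
     exists M, forall z', normc z' <= 1 -> normc (z' - z) < e -> B z' M) ->
  exists M, forall z, normc z <= 1 -> B z M.
Proof.
move=> Bmono Bloc.
pose K : set (R * R) := `[-1, 1]%classic `*` `[-1, 1]%classic.
have /compact_near_coveringP cK : compact K.
  by apply: compact_setX; exact: segment_compact.
pose P (M : R) (p : R * R) := normc (p.1 +i* p.2) <= 1 -> B (p.1 +i* p.2) M.
have near_pt (x y e : R) : 0 < e ->
    \forall p \near (x, y), normc (p.1 +i* p.2 - x +i* y) < e.
  move=> e0; have e20 : 0 < e / 2 by rewrite divr_gt0.
  exists (ball x (e / 2), ball y (e / 2)); first by split; exact: nbhsx_ballx.
  case=> x' y' [] /=; rewrite /ball /= => hx hy.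
  apply: le_lt_trans (le_normc_coord _ _) _.
  by rewrite [`|x' - x|]distrC [`|y' - y|]distrC; lra.
have [] := cK _ (pinfty_nbhs R) P _.
  case=> x y _ /=.
  have [z1|z1] := leP (normc (x +i* y)) 1.
    have [e e0 [M BM]] := Bloc _ z1.
    exists ([set p | normc (p.1 +i* p.2 - x +i* y) < e], [set M' | M <= M']).
      by split; [exact: near_pt | exact: nbhs_pinfty_ge (num_real M)].
    by case=> p M' [/= pe MM'] p1; apply: Bmono MM' _; exact: BM.
  exists ([set p | normc (p.1 +i* p.2 - x +i* y) < normc (x +i* y) - 1], setT).
    by split; [apply: near_pt; rewrite subr_gt0 | exact: filterT].
  case=> p M' [pe _] p1; exfalso.
  have {}pe : normc (p.1 +i* p.2 - x +i* y) < normc (x +i* y) - 1 by [].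
  have := le_normcD (p.1 +i* p.2) (- (p.1 +i* p.2 - x +i* y)).
  rewrite opprB addrC subrK -opprB normcN.
  set u := normc (p.1 +i* p.2) in p1 *.
  set v := normc (x +i* y) in pe z1 *.
  set w := normc (p.1 +i* p.2 - x +i* y) in pe *.
  by lra.
move=> M [_ KP]; exists (M + 1) => -[x y] z1.
have [x1 y1] := coord_le_normc x y.
apply: (KP (M + 1) _ (x, y)) => //=; first by rewrite ltrDl.
by split; rewrite /= in_itv /= -ler_norml; [exact: le_trans x1 z1 | exact: le_trans y1 z1].
Qed.

Lemma unit_root_of_opp1 n : (0 < n)%N -> exists2 w : R[i], w ^+ n = -1 & normc w = 1.
Proof.
move=> n0; exists (n.-root (-1)); first exact: rootCK.
have : `|n.-root (-1 : R[i])| = 1.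
  by apply/eqP; rewrite -(@pexpr_eq1 _ _ n) // -normrX rootCK // normrN1.
by move=> /(congr1 (@complex.Re R)).
Qed.

End Complex.

(** * Norm, inverses and the Neumann series *)

Section Norm.
Variables (R : realType) (A : cstarAlgType R).
Implicit Types (a b u x y : A) (k z : R[i]).

Lemma cnorm_scale k a : cnorm (k *: a) = normc k * cnorm a.
Proof. by have /(congr1 (@complex.Re R)) := cnormZ k a; rewrite -rmorphM. Qed.

Lemma cnorm_scaleR (t : R) a : 0 <= t -> cnorm (t%:C *: a) = t * cnorm a.
Proof. by move=> t0; rewrite cnorm_scale normc_real ger0_norm. Qed.

Lemma cnorm0 : cnorm (0 : A) = 0.
Proof. by rewrite -(scale0r (0 : A)) cnorm_scale normc0 mul0r. Qed.

Lemma cnormN a : cnorm (- a) = cnorm a.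
Proof. by rewrite -scaleN1r cnorm_scale normcN normc1 mul1r. Qed.

Lemma cnormB a b : cnorm (a - b) = cnorm (b - a).
Proof. by rewrite -opprB cnormN. Qed.

Lemma cnorm_ge0 a : 0 <= cnorm a.
Proof. by have := cnormD a (- a); rewrite subrr cnorm0 cnormN; lra. Qed.

Lemma star1 : star (1 : A) = 1.
Proof. by have := starM (star 1) (1 : A); rewrite mulr1 starK mulr1. Qed.

Lemma star0 : star (0 : A) = 0.
Proof. by apply: (addrI (star 0)); rewrite -starD !addr0. Qed.

Lemma starN a : star (- a) = - star a.
Proof. by apply: (addrI (star a)); rewrite -starD !subrr star0. Qed.

Lemma cnorm1 : cnorm (1 : A) = 1.
Proof.
have := cnorm_star (1 : A); rewrite star1 mul1r expr2 => h.
have n0 : cnorm (1 : A) != 0.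
  by apply/eqP => /cnorm_eq0 /eqP; rewrite oner_eq0.
by apply: (mulfI n0); rewrite -h mulr1.
Qed.

Lemma cnorm_exp a n : cnorm (a ^+ n) <= cnorm a ^+ n.
Proof.
elim: n => [|n IHn]; first by rewrite !expr0 cnorm1.
rewrite !exprS; apply: le_trans (cnormM _ _) _.
by apply: ler_wpM2l => //; exact: cnorm_ge0.
Qed.

Lemma cnorm_star_eq a : cnorm (star a) = cnorm a.
Proof.
have le_star b : cnorm b <= cnorm (star b).
  have := cnormM (star b) b; rewrite cnorm_star expr2.
  have := cnorm_ge0 b; rewrite le_eqVlt => /predU1P[<- _|b0].
    exact: cnorm_ge0.
  by rewrite ler_pM2r.
by apply/eqP; rewrite eq_le le_star -[leRHS]/(cnorm a) -{2}[a]starK le_star.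
Qed.

Lemma expr_small (q e : R) : 0 <= q -> q < 1 -> 0 < e ->
  exists N, forall n, (N <= n)%N -> q ^+ n < e.
Proof.
move=> q0 q1 e0.
have := @cvg_expr R q; rewrite ger0_norm // => /(_ q1) /cvgrPdist_lt /(_ _ e0).
case=> N _ HN; exists N => n Nn.
by have := HN _ Nn; rewrite /= sub0r normrN ger0_norm // exprn_ge0.
Qed.

Definition mutual_inverses x y := x * y = 1 /\ y * x = 1.

Lemma invertibleM x y : invertible x -> invertible y -> invertible (x * y).
Proof.
move=> [x' [xx' x'x]] [y' [yy' y'y]]; exists (y' * x'); split.
  by rewrite mulrA -(mulrA x) yy' mulr1.
by rewrite mulrA -(mulrA y') x'x mulr1.
Qed.

Lemma invertibleZ k x : k != 0 -> invertible (k *: x) <-> invertible x.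
Proof.
move=> k0; split => -[y [xy yx]]; first exists (k *: y); last exists (k^-1 *: y).
  by rewrite -scalerAr scalerAl xy -scalerAl scalerAr.
by rewrite -!scalerAl -!scalerAr !scalerA mulVf // mulfV // !scale1r.
Qed.

(** The Neumann series.  Its partial sums u satisfy
    (1 - q) ||u_(m+j) - u_m|| <= q^m with q = ||x||, and their limit inverts
    1 - x because (1 - x) u_n = 1 - x^n = u_n (1 - x). *)
Lemma invertible_1sub x : cnorm x < 1 -> invertible (1 - x).
Proof.
move=> x1; set q := cnorm x in x1; have q0 : 0 <= q := cnorm_ge0 x.
pose u n := \sum_(i < n) x ^+ i.
have uS n : u n.+1 = u n + x ^+ n by rewrite /u big_ord_recr.
have uE n : (1 - x) * u n = 1 - x ^+ n.
  rewrite -[in RHS](expr1n A n) subrXX_comm; last exact/commr_sym/commr1.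
  by congr (_ * _); apply: eq_bigr => i _; rewrite expr1n mul1r.
have uC n : u n * (1 - x) = (1 - x) * u n.
  by apply/esym/commr_sum => i _; apply/commrX/commr_sym/commrB;
    [exact: commr1 | exact: commr_refl].
have tail m j : (1 - q) * cnorm (u (m + j)%N - u m) <= q ^+ m.
  suff : (1 - q) * cnorm (u (m + j)%N - u m) <= q ^+ m - q ^+ (m + j).
    by move/le_trans; apply; rewrite lerBlDr lerDl exprn_ge0.
  elim: j => [|j IHj]; first by rewrite addn0 !subrr cnorm0 mulr0.
  rewrite addnS uS addrAC.
  have le_u := cnormD (u (m + j)%N - u m) (x ^+ (m + j)).
  have le_x := cnorm_exp x (m + j); rewrite -/q in le_x.
  apply: (le_trans (y := (1 - q) * (cnorm (u (m + j)%N - u m) + q ^+ (m + j)))).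
    by apply: ler_wpM2l; lra.
  by rewrite [q ^+ (m + j).+1]exprS; lra.
have q1 : 0 < 1 - q by rewrite subr_gt0.
have [e e0|l ul] := @cnorm_complete R A u.
  have [N HN] := expr_small q0 x1 (mulr_gt0 q1 e0).
  have key m n : (N <= m)%N -> (m <= n)%N -> cnorm (u n - u m) < e.
    move=> Nm mn; rewrite -(ltr_pM2l q1); apply: le_lt_trans (HN _ Nm).
    by rewrite -(subnKC mn).
  exists N => m n Nm Nn; have [mn|/ltnW nm] := leqP m n.
    by rewrite cnormB; exact: key.
  exact: key.
have lim_eq (w : A) : (forall e, 0 < e -> cnorm w < e) -> w = 0.
  move=> h; apply: cnorm_eq0; apply/le_anti/andP; split; last exact: cnorm_ge0.
  by apply/ler_addgt0Pl => e e0; rewrite addr0 ltW ?h.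
have small e : 0 < e -> exists n, cnorm (u n - l) < e / 4 /\ cnorm (x ^+ n) < e / 2.
  move=> e0; have [N1 H1] := ul (e / 4) (divr_gt0 e0 (ltr0n _ 4)).
  have [N2 H2] := expr_small q0 x1 (divr_gt0 e0 (ltr0n _ 2)).
  exists (maxn N1 N2); split; first by rewrite H1 // leq_maxl.
  by apply: le_lt_trans (cnorm_exp _ _) _; rewrite H2 // leq_maxr.
have n1x : cnorm (1 - x) <= 2.
  by have := cnormD 1 (- x); rewrite cnormN cnorm1 -/q; lra.
exists l; split; apply/subr0_eq/lim_eq => e e0; have [n [H1 H2]] := small e e0.
  have -> : (1 - x) * l - 1 = - ((1 - x) * (u n - l)) - x ^+ n.
    by rewrite mulrBr uE !opprB addrA [RHS]addrAC addrK.
  have := cnormD (- ((1 - x) * (u n - l))) (- x ^+ n); rewrite !cnormN.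
  have := cnormM (1 - x) (u n - l).
  have : cnorm (1 - x) * cnorm (u n - l) <= 2 * cnorm (u n - l).
    by apply: ler_wpM2r => //; exact: cnorm_ge0.
  by lra.
have -> : l * (1 - x) - 1 = - ((u n - l) * (1 - x)) - x ^+ n.
  by rewrite mulrBl uC uE !opprB addrA [RHS]addrAC addrK.
have := cnormD (- ((u n - l) * (1 - x))) (- x ^+ n); rewrite !cnormN.
have := cnormM (u n - l) (1 - x).
have : cnorm (u n - l) * cnorm (1 - x) <= cnorm (u n - l) * 2.
  by apply: ler_wpM2l => //; exact: cnorm_ge0.
by lra.
Qed.

Lemma spectrum_le_cnorm a k : spectrum a k -> normc k <= cnorm a.
Proof.
move=> ka; rewrite leNgt; apply/negP => ak; apply: ka.
have k0 : 0 < normc k := le_lt_trans (cnorm_ge0 a) ak.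
have kn0 : k != 0 by apply: contraTneq k0 => ->; rewrite normc0 ltxx.
have -> : k%:A - a = k *: (1 - k^-1 *: a).
  by rewrite scalerBr scalerA mulfV // scale1r.
apply/invertibleZ => //; apply: invertible_1sub.
by rewrite cnorm_scale normcV mulrC ltr_pdivrMr // mul1r.
Qed.

End Norm.

(** * Spectral radius of hermitian elements *)

Section SpectralRadius.
Variables (R : realType) (A : cstarAlgType R).
Implicit Types (a b h u w x y : A) (k z : R[i]).

(** The resolvent identity. *)
Lemma mutual_inverses_sub x y x' y' :
  mutual_inverses x y -> mutual_inverses x' y' -> y - y' = y * (x' - x) * y'.
Proof.
by move=> [_ yx] [x'y' _]; rewrite mulrBr mulrBl -mulrA x'y' mulr1 yx mul1r.
Qed.

(** Inverses of the factors 1 - p and 1 + p in terms of an inverse of 1 - p^2. *)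
Lemma mutual_inverses_factor x x' y : GRing.comm x x' ->
  mutual_inverses (x * x') y -> mutual_inverses x (y * x').
Proof.
move=> xx' [inv1 inv2].
have left_inv : y * x' * x = 1 by rewrite -mulrA -xx'.
have yx' : y * x' = x' * y.
  by rewrite -[LHS]mulr1 -inv1 -[x * x' * y]mulrA mulrA left_inv mul1r.
by split=> //; rewrite yx' mulrA.
Qed.

Lemma sub1_sqr x : 1 - x ^+ 2 = (1 - x) * (1 + x).
Proof. by rewrite mulrBl mul1r mulrDr mulr1 expr2 opprD addrA addrK. Qed.

Lemma comm_sub1_add1 x : GRing.comm (1 - x) (1 + x).
Proof.
by rewrite /GRing.comm -sub1_sqr mulrBr mulr1 mulrDl mul1r expr2 opprD addrA addrK.
Qed.

(** By the resolvent identity, ||y|| <= ||y0|| + ||y|| / 2 for the inverses y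
    and y0 at two points that are close enough, so the inverse is bounded by
    2 ||y0|| near each point. *)
Lemma resolvent_bounded u :
  (forall z, normc z <= 1 -> invertible (1 - z *: u)) ->
  exists M, forall z, normc z <= 1 ->
    forall y, mutual_inverses (1 - z *: u) y -> cnorm y <= M.
Proof.
move=> uinv.
apply: (@locally_bounded_on_unit_disk R
  (fun z M => forall y, mutual_inverses (1 - z *: u) y -> cnorm y <= M)).
  by move=> z M M' MM' BM y /BM /le_trans; apply.
move=> z /uinv [y0 y0inv].
have c0 : 0 < cnorm u * cnorm y0 + 1.
  by rewrite ltr_wpDl // mulr_ge0 // cnorm_ge0.
(* The added 1 keeps the radius finite when u = 0. *)
exists (2 * (cnorm u * cnorm y0 + 1))^-1; first by rewrite invr_gt0 mulr_gt0.
exists (2 * cnorm y0) => z' _ zz' y yinv.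
have := mutual_inverses_sub yinv y0inv.
have -> : 1 - z *: u - (1 - z' *: u) = (z' - z) *: u.
  by rewrite opprB addrC addrA subrK -scalerBl.
move=> yE.
have : cnorm y <= cnorm y0 + cnorm y * (normc (z' - z) * (cnorm u * cnorm y0)).
  rewrite -{1}[y](subrK y0) yE addrC; apply: le_trans (cnormD _ _) _.
  rewrite lerD2l; apply: le_trans (cnormM _ _) _.
  rewrite !mulrA; apply: ler_wpM2r; first exact: cnorm_ge0.
  by apply: le_trans (cnormM _ _) _; rewrite cnorm_scale mulrA.
have half : normc (z' - z) * (cnorm u * cnorm y0) <= 2^-1.
  apply: (le_trans (y := (2 * (cnorm u * cnorm y0 + 1))^-1 * (cnorm u * cnorm y0 + 1))).
    apply: ler_pM; rewrite ?normc_ge0 ?mulr_ge0 ?cnorm_ge0 ?(ltW zz') //.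
    by rewrite lerDl.
  by rewrite invfM -mulrA mulVf ?mulr1 // gt_eqF.
have := ler_wpM2l (cnorm_ge0 y) half.
by lra.
Qed.

Lemma power_resolvent_invertible u :
  (forall z, normc z <= 1 -> invertible (1 - z *: u)) ->
  forall n z, normc z <= 1 -> invertible (1 - (z *: u) ^+ (2 ^ n)).
Proof.
move=> uinv n; elim: n => [z /uinv//|n IHn z z1].
have [w wE w1] := @unit_root_of_opp1 R (2 ^ n) (expn_gt0 2 n).
have wz1 : normc (w * z) <= 1 by rewrite normcM w1 mul1r.
rewrite expnSr exprM sub1_sqr.
apply: invertibleM; first exact: IHn.
have := IHn _ wz1.
by rewrite -scalerA exprZn wE scaleN1r opprK.
Qed.

(** The inverse of 1 - p^2 is the mean of those of 1 - p and 1 + p.  Since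
    1 + p = 1 - (wzu)^(2^n) for a w of modulus 1, a bound that is uniform on the
    disk passes from exponent 2^n to 2^(n+1) without loss. *)
Lemma power_resolvent_close u (s eta : R) :
  (forall z y y', normc z <= 1 -> mutual_inverses (1 - z *: u) y ->
    mutual_inverses (1 - (s%:C * z) *: u) y' -> cnorm (y - y') <= eta) ->
  forall n z y y', normc z <= 1 ->
    mutual_inverses (1 - (z *: u) ^+ (2 ^ n)) y ->
    mutual_inverses (1 - ((s%:C * z) *: u) ^+ (2 ^ n)) y' ->
    cnorm (y - y') <= eta.
Proof.
move=> close; elim=> [|n IHn] z y y' z1; first by rewrite expn0 !expr1; exact: close.
have [w wE w1] := @unit_root_of_opp1 R (2 ^ n) (expn_gt0 2 n).
have wz1 : normc (w * z) <= 1 by rewrite normcM w1 mul1r.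
have wpow z' : ((w * z') *: u) ^+ (2 ^ n) = - (z' *: u) ^+ (2 ^ n).
  by rewrite -scalerA exprZn wE scaleN1r.
have IHp y1 y2 := IHn z y1 y2 z1; have IHw y1 y2 := IHn (w * z) y1 y2 wz1.
move: IHp IHw; rewrite expnSr !exprM [s%:C * (w * z)]mulrCA !wpow !opprK.
set p := (z *: u) ^+ _; set q := (_ *: u) ^+ _ => IHp IHw.
rewrite !sub1_sqr => invp invq.
have b1 := IHp _ _ (mutual_inverses_factor (comm_sub1_add1 p) invp)
  (mutual_inverses_factor (comm_sub1_add1 q) invq).
rewrite !comm_sub1_add1 in invp invq.
have b2 := IHw _ _ (mutual_inverses_factor (commr_sym (comm_sub1_add1 p)) invp)
  (mutual_inverses_factor (commr_sym (comm_sub1_add1 q)) invq).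
have avg x v : v * (1 + x) + v * (1 - x) = 2%:C *: v :> A.
  by rewrite -mulrDr addrACA subrr addr0 mulrDr mulr1 -[in RHS](natr1 1)
    rmorphD scalerDl scale1r.
suff : 2 * cnorm (y - y') <= eta + eta by lra.
rewrite -cnorm_scaleR // scalerBr -(avg p) -(avg q) opprD addrACA.
exact: le_trans (cnormD _ _) (lerD b1 b2).
Qed.

Lemma hermitianX h n : hermitian h -> hermitian (h ^+ n).
Proof.
move=> hh; rewrite /hermitian; elim: n => [|n IHn]; first by rewrite expr0 star1.
by rewrite exprSr starM IHn hh -exprS -exprSr.
Qed.

Lemma cnorm_hermitian_pow2 h n : hermitian h ->
  cnorm (h ^+ (2 ^ n)) = cnorm h ^+ (2 ^ n).
Proof.
move=> hh; elim: n => [|n IHn]; first by rewrite expn0 !expr1.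
by rewrite expnSr !exprM -IHn -cnorm_star expr2 (hermitianX _ hh).
Qed.

(** The core of the spectral radius theorem: the inverses y of 1 - u^(2^N) and y'
    of 1 - (su)^(2^N) are within 1/4 of each other, and ||(su)^(2^N)|| <= 1/8
    puts y' within 1/7 of 1.  So ||y - 1|| < 1/2, and then the identity
    p = (y - 1) - (y - 1) p forces ||p|| < 1 for p = u^(2^N). *)
Lemma unit_hermitian_singular_in_disk u : hermitian u -> cnorm u = 1 ->
  ~ (forall z, normc z <= 1 -> invertible (1 - z *: u)).
Proof.
move=> uh u1 uinv.
have [M bM] := resolvent_bounded uinv.
have M1 : 1 <= M.
  have := bM 0; rewrite normc0 scale0r subr0 => /(_ ler01 1).
  by rewrite cnorm1; apply; split; rewrite mulr1.
have M0 : M != 0 by rewrite gt_eqF //; lra.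
(* By the resolvent identity the inverses at z and sz differ by at most
   M (1 - s) M, so this choice of 1 - s makes the difference at most 1/4. *)
pose del := (4 * M * M)^-1.
have M2 : 1 <= M * M by rewrite -[1]mulr1 ler_pM.
have del0 : 0 < del by rewrite /del invr_gt0; nra.
have del1 : del <= 4^-1 by rewrite /del lef_pV2 ?posrE; nra.
pose s := 1 - del.
have s0 : 0 <= s by rewrite /s; lra.
have s1 : s < 1 by rewrite /s; lra.
have close z y y' : normc z <= 1 -> mutual_inverses (1 - z *: u) y ->
    mutual_inverses (1 - (s%:C * z) *: u) y' -> cnorm (y - y') <= 4^-1.
  move=> z1 invy invy'.
  have sz1 : normc (s%:C * z) <= 1.
    by rewrite normcM normc_real ger0_norm // mulr_ile1 // ?normc_ge0 // ltW.
  have yM := bM _ z1 _ invy; have y'M := bM _ sz1 _ invy'.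
  rewrite (mutual_inverses_sub invy invy').
  have -> : 1 - (s%:C * z) *: u - (1 - z *: u) = (del%:C * z) *: u.
    rewrite opprB addrC addrA subrK -scalerBl; congr (_ *: u).
    by rewrite -[z in z - _]mul1r -mulrBl /s rmorphB /= opprB addrC subrK.
  apply: le_trans (cnormM _ _) _.
  apply: (le_trans (y := (M * del) * M)); last first.
    by rewrite le_eqVlt; apply/orP; left; apply/eqP; rewrite /del; field.
  apply: ler_pM; rewrite ?cnorm_ge0 //.
  apply: le_trans (cnormM _ _) _.
  apply: ler_pM; rewrite ?cnorm_ge0 //.
  rewrite cnorm_scale u1 mulr1 normcM normc_real gtr0_norm //.
  by rewrite ger_pMr.
have e0 : 0 < 8^-1 :> R by rewrite invr_gt0.
have [N sN] := expr_small s0 s1 e0.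
have pN : s ^+ (2 ^ N) < 8^-1 by apply: sN; rewrite ltnW // ltn_expl.
have normc1' : normc (1 : R[i]) <= 1 by rewrite normc1.
have sn1 : normc (s%:C : R[i]) <= 1 by rewrite normc_real ger0_norm // ltW.
have [y invy] := power_resolvent_invertible uinv N normc1'.
have [y' invy'] := power_resolvent_invertible uinv N sn1.
have := power_resolvent_close close normc1' invy.
rewrite mulr1 => /(_ _ invy') yy'.
have uN : cnorm (u ^+ (2 ^ N)) = 1 by rewrite cnorm_hermitian_pow2 // u1 expr1n.
have suN : cnorm ((s%:C *: u) ^+ (2 ^ N)) <= 8^-1.
  by apply: le_trans (cnorm_exp _ _) _; rewrite cnorm_scaleR // u1 mulr1 ltW.
rewrite scale1r in invy.
move: (u ^+ _) ((_ *: u) ^+ _) uN suN invy invy' => p q p1 q8 [_ yp] [_ y'q].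
have y'E : y' - 1 = y' * q by rewrite -y'q mulrBr mulr1 opprB addrC subrK.
have yE : p = (y - 1) - (y - 1) * p.
  rewrite -[p in RHS]opprK mulrN opprK -[X in X + _]mulr1 -mulrDr.
  by rewrite mulrBl yp mul1r opprB addrC subrK.
have h1 : cnorm (y' - 1) <= cnorm y' * 8^-1.
  rewrite y'E; apply: le_trans (cnormM _ _) _.
  by apply: ler_wpM2l => //; exact: cnorm_ge0.
have h2 : cnorm y' <= cnorm (y' - 1) + 1.
  by have := cnormD (y' - 1) 1; rewrite subrK cnorm1.
have h3 : cnorm (y - 1) <= cnorm (y - y') + cnorm (y' - 1).
  by have := cnormD (y - y') (y' - 1); rewrite addrA subrK.
have h4 : 1 <= cnorm (y - 1) + cnorm (y - 1) * 1.
  rewrite -{1}p1 {1}yE; apply: le_trans (cnormD _ _) _.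
  by rewrite cnormN lerD2l; have := cnormM (y - 1) p; rewrite p1.
by lra.
Qed.

Lemma invertible1 : invertible (1 : A).
Proof. by exists 1; rewrite mulr1. Qed.

Lemma not_invertible0 : ~ invertible (0 : A).
Proof. by case=> b [/eqP]; rewrite mul0r eq_sym oner_eq0. Qed.

(** For h != 0 this applies the previous lemma to h / ||h||: if |z| <= 1, then
    ||h|| / z has modulus above rho, hence is outside the spectrum.  No sign is
    imposed on rho, since the spectrum of 0 contains 0. *)
Lemma cnorm_le_spectral_bound h (rho : R) : hermitian h ->
  (forall k, spectrum h k -> normc k <= rho) -> cnorm h <= rho.
Proof.
move=> hh spec; rewrite leNgt; apply/negP => rho_h.
have [h0|hn0] := eqVneq (cnorm h) 0.
  have : spectrum h 0.
    by rewrite /spectrum /= (cnorm_eq0 h h0) scale0r subrr; exact: not_invertible0.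
  by move=> /spec; rewrite normc0 leNgt -h0 rho_h.
have hpos : 0 < cnorm h by rewrite lt_neqAle eq_sym hn0 cnorm_ge0.
set c := cnorm h in rho_h hn0 hpos.
apply: (@unit_hermitian_singular_in_disk ((c^-1)%:C *: h)).
- by rewrite /hermitian starZ hh /= oppr0.
- by rewrite cnorm_scaleR ?invr_ge0 ?(ltW hpos) // mulVf.
move=> z z1; have [->|z0] := eqVneq z 0.
  by rewrite scale0r subr0; exact: invertible1.
have cz0 : c%:C * z^-1 != 0.
  by rewrite mulf_neq0 ?invr_eq0 // eq_complex /= negb_and hn0.
apply/(invertibleZ _ cz0).
have -> : (c%:C * z^-1) *: (1 - z *: ((c^-1)%:C *: h)) = (c%:C * z^-1)%:A - h.
  rewrite scalerBr; congr (_ - _); rewrite [z *: _]scalerA [LHS]scalerA -mulrA mulKf //.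
  by rewrite -rmorphM /= divff // scale1r.
apply: contrapT => /spec; apply/negP; rewrite -ltNge.
rewrite normcM normcV normc_real gtr0_norm //.
apply: lt_le_trans rho_h _.
have nz : 0 < normc z.
  by rewrite lt_neqAle normc_ge0 andbT; apply: contra_neq z0 => /esym/eq0_normc.
by rewrite ler_pdivlMr // ger_pMr.
Qed.

End SpectralRadius.

(** * Positive elements *)

Section PositiveElements.
Variables (R : realType) (A : cstarAlgType R).
Implicit Types (a b p q w : A) (k : R[i]).

Lemma hermitianD a b : hermitian a -> hermitian b -> hermitian (a + b).
Proof. by rewrite /hermitian starD => -> ->. Qed.

Lemma hermitianN a : hermitian a -> hermitian (- a).
Proof. by rewrite /hermitian starN => ->. Qed.

Lemma hermitian_scalar (t : R) : hermitian (t%:C%:A : A).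
Proof. by rewrite /hermitian starZ star1 /= oppr0. Qed.

Lemma spectrum_positive p k : positive p -> spectrum p k ->
  exists x : R, [/\ k = x%:C, 0 <= x & x <= cnorm p].
Proof.
move=> [_ ppos] pk; have k0 : 0 <= k := ppos _ pk.
have kE : k = (complex.Re k)%:C by rewrite RRe_real // ger0_real.
have x0 : 0 <= complex.Re k by rewrite kE lecR in k0.
exists (complex.Re k); split=> //.
by have := spectrum_le_cnorm pk; rewrite {1}kE normc_real ger0_norm.
Qed.

Lemma invertibleN a : invertible a -> invertible (- a).
Proof. by case=> b [ab ba]; exists (- b); rewrite !mulrNN. Qed.

(** The spectrum of t - q is the reflection of that of q, so it lies in
    [0, t]. *)
Lemma cnorm_scalar_sub_positive q (t : R) : positive q -> cnorm q <= t ->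
  cnorm (t%:C%:A - q) <= t.
Proof.
move=> qpos qt; apply: cnorm_le_spectral_bound.
  by apply: hermitianD (hermitianN _); [exact: hermitian_scalar | case: qpos].
move=> k kspec.
have /(spectrum_positive qpos)[x [xE x0 xq]] : spectrum q (t%:C - k).
  move=> /invertibleN inv; apply: kspec.
  suff -> : k%:A - (t%:C%:A - q) = - ((t%:C - k)%:A - q) by [].
  by rewrite scalerBl !opprB addrCA.
have -> : k = (t - x)%:C by rewrite rmorphB /= -xE opprB addrC subrK.
by rewrite normc_real ger0_norm; lra.
Qed.

(** Shifting by t moves each x in the spectrum of p to x + t, which is at most
    ||p + t||; the spectral radius theorem turns this bound on all x into one on
    ||p||. *)
Lemma cnorm_positive_add_scalar p (t : R) : positive p -> 0 <= t ->
  cnorm p + t <= cnorm (p + t%:C%:A).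
Proof.
move=> ppos t0; rewrite -lerBrDr; apply: cnorm_le_spectral_bound; first by case: ppos.
move=> k kspec; have [x [kE x0 _]] := spectrum_positive ppos kspec.
have : spectrum (p + t%:C%:A) (x + t)%:C.
  by move: kspec; rewrite /spectrum /= kE rmorphD /= scalerDl opprD addrACA subrr addr0.
move=> /spectrum_le_cnorm; rewrite kE !normc_real !ger0_norm ?addr_ge0 //.
by rewrite lerBrDr.
Qed.

(** This takes the place of the theorem that sums of positive elements are
    positive: the bounds ||t - q|| <= t and ||s - w|| <= s, with t = ||q|| and
    s = ||w||, add up by the triangle inequality. *)
Lemma cnorm_le_positive_sum p q w : positive p -> positive q -> positive w ->
  cnorm p <= cnorm (p + q + w).
Proof.
move=> ppos qpos wpos; set t := cnorm q; set s := cnorm w.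
have := cnorm_positive_add_scalar ppos (addr_ge0 (cnorm_ge0 q) (cnorm_ge0 w)).
have -> : p + (cnorm q + cnorm w)%:C%:A
    = (p + q + w) + (t%:C%:A - q) + (s%:C%:A - w).
  have cancel x y z : x + y + (z - y) = x + z :> A.
    by rewrite addrC -addrA [x + y]addrC addKr addrC.
  by rewrite rmorphD scalerDl [_ + w + (_ - q)]addrAC !cancel addrA.
have := cnormD (p + q + w + (t%:C%:A - q)) (s%:C%:A - w).
have := cnormD (p + q + w) (t%:C%:A - q).
have := cnorm_scalar_sub_positive qpos (lexx _).
have := cnorm_scalar_sub_positive wpos (lexx _).
by rewrite -/t -/s; lra.
Qed.

Lemma positive0 : positive (0 : A).
Proof.
split=> [|k]; first exact: star0.
by move=> /spectrum_le_cnorm; rewrite cnorm0 /= => k0;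
  rewrite (@eq0_normc R k) //; apply/le_anti; rewrite k0 normc_ge0.
Qed.

Lemma cnorm_positive_le a b : positive a -> a ⪯ b -> cnorm a <= cnorm b.
Proof.
move=> apos [_ _ bpos].
by have := cnorm_le_positive_sum apos bpos positive0; rewrite addr0 addrC subrK.
Qed.

Lemma positive_sum3_eq0 p q w : positive p -> positive q -> positive w ->
  p + q + w = 0 -> p = 0.
Proof.
move=> ppos qpos wpos sum0; apply: cnorm_eq0; apply/le_anti.
rewrite cnorm_ge0 andbT -(cnorm0 A) -sum0.
exact: cnorm_le_positive_sum.
Qed.

Lemma le0_positive a : 0 ⪯ a -> positive a.
Proof. by case=> _ _; rewrite subr0. Qed.

End PositiveElements.

(** * The fixed circle *)

Unset Implicit Arguments.
Set Strict Implicit.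

Theorem theorem9 (R : realType) (A : cstarAlgType R) (X : Type)
  (d : X -> X -> A) (hd : cstar_metric_space d)
  (x0 : X) (r : A) (hr : positive r)
  (phi : X -> A) (hphi : forall x, phi x = d x x0)
  (T : X -> X)
  (hT1 : forall x, circle d x0 r x -> d x (T x) ⪯ phi x - phi (T x))
  (hT2 : forall x, circle d x0 r x -> r ⪯ d (T x) x0)
  (a : A) (ha : cnorm a < 1)
  (hcontr : forall x y, circle d x0 r x -> (~` circle d x0 r) y ->
     d (T x) (T y) ⪯ star a * d x y * a) :
  unique_fixed_circle d T x0 r.
Proof.
have dpos x y : positive (d x y) by exact/le0_positive/(cmetric_ge0 hd).
have fixC : fixed_circle d T x0 r.
  move=> x xC; apply/esym/(cmetric_eq0 hd).
  have [_ _ p1] := hT1 x xC; have [_ _ p2] := hT2 x xC.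
  apply: (positive_sum3_eq0 (dpos _ _) p1 p2).
  have xr : d x x0 = r := xC.
  by rewrite !hphi xr [d x (T x) + _]addrC subrK addrA subrK subrr.
split=> // -[x xC] x1 r1 _ fix1 notproper.
have sub : circle d x1 r1 `<=` circle d x0 r.
  move=> y y1; apply: contrapT => yC.
  have := hcontr x y xC yC; rewrite (fixC x xC) (fix1 y y1).
  move=> /(cnorm_positive_le (dpos x y)) le_b.
  have b0 : cnorm (d x y) = 0.
    have := cnorm_ge0 (d x y); rewrite le_eqVlt => /predU1P[<-//|bpos].
    have := cnormM (star a * d x y) a.
    have := ler_wpM2r (cnorm_ge0 a) (cnormM (star a) (d x y)).
    rewrite cnorm_star_eq => l1 l2.
    have a0 := cnorm_ge0 a.
    have : cnorm a * cnorm (d x y) < cnorm (d x y) by rewrite gtr_pMl.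
    have : cnorm a * cnorm (d x y) * cnorm a <= cnorm a * cnorm (d x y).
      by rewrite ler_piMr ?mulr_ge0 ?cnorm_ge0 // ltW.
    by lra.
  have /(cmetric_eq0 hd) xy := cnorm_eq0 _ b0.
  by apply: yC; rewrite -xy.
apply: contrapT => ne; apply: notproper; split=> // sup; apply: ne.
by rewrite eqEsubset.
Qed.
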